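(* Let $Q$ be a polyhedral partially ordered abelian group and let $D\subseteq Q$ be a downset. Then $D$ has a canonical primary decomposition $$D=\bigcup_\tau P_\tau(D),$$ the union being over all faces $\tau$ of the positive cone $Q_+$ such that the local $\tau$-support $\Gamma_\tau(D_\tau)$ is nonempty.
   Context: An abelian group $Q$ is partially ordered if it is generated by a submonoid $Q_+$ (the positive cone) with trivial unit group; the order is $q\preceq q'\iff q'-q\in Q_+$. A face of $Q_+$ is a submonoid $\sigma\subseteq Q_+$ such that $Q_+\setminus\sigma$ is an ideal of the monoid $Q_+$. $Q$ is polyhedral if it has only finitely many faces. A downset is a subset $D\subseteq Q$ with $D-Q_+=D$. For a downset $D$ and a face $\tau$, the localization of $D$ along $\tau$ is $D_\tau=\{q\in D\mid q+\tau\subseteq D\}$, again a downset. An element $q\in D$ is globally supported on $\tau$ if $q\notin D_{\tau'}$ for every face $\tau'\not\subseteq\tau$; $\Gamma_\tau D$ is the set of elements of $D$ globally supported on $\tau$. The local $\tau$-support of $D$ is $\Gamma_\tau(D_\tau)$. The $\tau$-primary component of $D$ is the downset $P_\tau(D)=\Gamma_\tau(D_\tau)-Q_+$. A downset $D'$ is coprimary if $D'=P_\tau(D')$ for some face $\tau$ of $Q_+$. A primary decomposition of $D$ is an expression $D=\bigcup_{i=1}^r D_i$ as a finite union of coprimary downsets $D_i$. *)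

(* Defs.v *)
From mathcomp Require Import all_boot all_algebra.
From mathcomp Require Import boolp classical_sets cardinality.

Set Implicit Arguments.
Unset Strict Implicit.
Unset Printing Implicit Defensive.

Import GRing.Theory.

Local Open Scope ring_scope.
Local Open Scope classical_set_scope.

Definition sumset (Q : zmodType) (A B : set Q) : set Q :=
  [set a + b | a in A & b in B].

Definition diffset (Q : zmodType) (A B : set Q) : set Q :=
  [set a - b | a in A & b in B].

Definition submonoid (Q : zmodType) (M : set Q) : Prop :=
  GRing.nmod_closed [in M].

Definition subgroup (Q : zmodType) (G : set Q) : Prop :=
  GRing.zmod_closed [in G].

Definition unit_group (Q : zmodType) (M : set Q) : set Q :=
  [set x | M x /\ M (- x)].

(* [smallest subgroup Qp] is the subgroup of [Q] generated by [Qp]. *)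
Definition partially_ordered (Q : zmodType) (Qp : set Q) : Prop :=
  [/\ submonoid Qp, smallest (@subgroup Q) Qp = setT & unit_group Qp = [set 0]].

(* Ideals of a monoid may be empty, so [Qp] is a face of itself. *)
Definition monoid_ideal (Q : zmodType) (Qp I : set Q) : Prop :=
  I `<=` Qp /\ sumset I Qp `<=` I.

Definition face (Q : zmodType) (Qp sigma : set Q) : Prop :=
  [/\ submonoid sigma, sigma `<=` Qp & monoid_ideal Qp (Qp `\` sigma)].

Definition polyhedral (Q : zmodType) (Qp : set Q) : Prop :=
  finite_set [set sigma | face Qp sigma].

Definition downset (Q : zmodType) (Qp D : set Q) : Prop :=
  diffset D Qp = D.

Definition localization (Q : zmodType) (tau D : set Q) : set Q :=
  [set q | D q /\ [set q + t | t in tau] `<=` D].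

Definition globally_supported (Q : zmodType) (Qp tau D : set Q) : set Q :=
  [set q | D q /\ forall tau', face Qp tau' -> ~ tau' `<=` tau ->
                    ~ localization tau' D q].

Definition local_support (Q : zmodType) (Qp tau D : set Q) : set Q :=
  globally_supported Qp tau (localization tau D).

Definition primary_component (Q : zmodType) (Qp tau D : set Q) : set Q :=
  diffset (local_support Qp tau D) Qp.

Definition coprimary (Q : zmodType) (Qp D : set Q) : Prop :=
  downset Qp D /\ exists2 tau, face Qp tau & D = primary_component Qp tau D.

(* The union is indexed by an arbitrary finite set rather than by 1, ..., r,
   so that a decomposition can be indexed directly by faces. *)
Definition primary_decomposition (Q : zmodType) (Qp D : set Q)
    (I : Type) (A : set I) (F : I -> set Q) : Prop :=
  [/\ finite_set A,
      forall i, A i -> coprimary Qp (F i) &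
      D = \bigcup_(i in A) F i].

(* Main.v *)
Require Import Defs.
From mathcomp Require Import all_boot all_algebra.
From mathcomp Require Import boolp classical_sets cardinality.

(** The union: given [q] in [D], among the faces [tau] such that some [p] above
    [q] lies in the localization of [D] along [tau], pick a maximal one; the
    face [0] is a candidate, with [p = q], and there are finitely many faces.
    Such a [p] belongs to the local [tau]-support.  Indeed, if [p] stayed in
    the localization of [D_tau] along a face [tau'], then [D] would contain
    [p + tau + tau'], hence [p + x] for all [x] in the face generated by
    [tau + tau'], because that face consists of the positive elements lying
    below some element of [tau + tau'] ([localization_face_join]).  Maximality
    of [tau] then forces [tau'] into [tau].  So [q], lying below [p], is in
    [P_tau(D)] ([downset_sub_components]).

    The pieces: [P_tau(D)] is its own [tau]-primary component.  The local
    support [S] of [D] is stable under translation by [tau]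
    ([local_support_translate]), so each of its points survives localizing
    [P_tau(D) = S - Q_+] along [tau].  It is still globally supported there,
    since [P_tau(D)] is contained in [D] and localization is monotone
    ([local_support_component]). *)

Set Implicit Arguments.
Unset Strict Implicit.

Local Open Scope ring_scope.
Local Open Scope classical_set_scope.

Import GRing.Theory.

Lemma finite_maximal_above (T : Type) (F P : set (set T)) (A : set T) :
  finite_set F -> P A ->
  exists M, [/\ A `<=` M, P M & forall B, F B -> P B -> M `<=` B -> B `<=` M].
Proof.
move=> /finite_seqP[s ->]; elim: s A => [|C s IHs] A PA.
  by exists A; split.
(* Moving up to C whenever that is possible ensures that the set obtained from
   the rest of the family cannot lie strictly below C. *)
have [[PC AC]|nAC] := pselect (P C /\ A `<=` C).
  have [M [CM PM maxM]] := IHs C PC.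
  exists M; split=> // [|B /=]; first exact: subset_trans CM.
  by rewrite inE => /orP[/eqP->|/maxM].
have [M [AM PM maxM]] := IHs A PA.
exists M; split=> // B /=; rewrite inE => /orP[/eqP-> PC MC|/maxM //].
by case: nAC; split=> //; exact: subset_trans MC.
Qed.

Section Submonoid.
Variables (Q : zmodType) (M : set Q).

Lemma submonoidP :
  submonoid M <-> M 0 /\ forall x y, M x -> M y -> M (x + y).
Proof.
split=> [[M0 MD]|[M0 MD]].
  split=> [|x y Mx My]; first exact: set_mem.
  by apply: set_mem; apply: MD; apply: mem_set.
split=> [|x y /set_mem Mx /set_mem My]; first exact: mem_set.
by apply: mem_set; apply: MD.
Qed.

End Submonoid.

Section PrimaryComponents.
Variables (Q : zmodType) (Qp : set Q).
Implicit Types A D E sigma tau : set Q.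
Hypothesis Qp_submonoid : submonoid Qp.

Let Qp0 : Qp 0. Proof. by have /submonoidP[] := Qp_submonoid. Qed.

Let QpD x y : Qp x -> Qp y -> Qp (x + y).
Proof. by have /submonoidP[_] := Qp_submonoid; apply. Qed.

Lemma diffset_below A x p :
  Qp p -> diffset A Qp (x + p) -> diffset A Qp x.
Proof.
move=> Qpp [a Aa [r Qpr]] /eqP; rewrite subr_eq => /eqP aE.
exists a => //; exists (p + r); first exact: QpD.
by rewrite aE -[x + p + r]addrA addrK.
Qed.

Lemma downsetP D :
  downset Qp D <-> forall x p, Qp p -> D (x + p) -> D x.
Proof.
split=> [<- x p|downD]; first exact: diffset_below.
apply/seteqP; split=> [_ [d Dd [r Qpr <-]]|x Dx].
  by apply: (downD _ r) => //; rewrite subrK.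
by exists x => //; exists 0; rewrite ?subr0.
Qed.

Lemma downset_diffset A : downset Qp (diffset A Qp).
Proof. by apply/downsetP => x p; exact: diffset_below. Qed.

Lemma diffset_sub_downset A D :
  downset Qp D -> A `<=` D -> diffset A Qp `<=` D.
Proof.
move=> /downsetP downD AD _ [a Aa [r Qpr <-]].
by apply: (downD _ r) => //; rewrite subrK; exact: AD.
Qed.

Lemma sub_diffset A : A `<=` diffset A Qp.
Proof. by move=> x Ax; exists x => //; exists 0; rewrite ?subr0. Qed.

Lemma face_of_summand sigma :
  submonoid sigma -> sigma `<=` Qp ->
  (forall x y, Qp x -> Qp y -> sigma (x + y) -> sigma x) -> face Qp sigma.
Proof.
move=> sub_s s_Qp summand; split=> //; split=> [x []//|].
move=> _ [x [Qpx nsx] [y Qpy <-]]; split; first exact: QpD.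
by move=> sxy; apply: nsx; exact: summand sxy.
Qed.

Lemma face0 : unit_group Qp = [set 0] -> face Qp [set 0].
Proof.
move=> units; apply: face_of_summand => [|_ ->//|x y Qpx Qpy /= xy0].
  by apply/submonoidP; split=> // _ _ -> ->; rewrite /= addr0.
suff: unit_group Qp x by rewrite units.
split=> //; move/eqP: xy0; rewrite addr_eq0 => /eqP->.
by rewrite opprK.
Qed.

(** The face generated by the submonoid [sigma + tau]. *)
Definition face_join (sigma tau : set Q) : set Q :=
  Qp `&` diffset (sumset sigma tau) Qp.

Section FaceJoin.
Variables sigma tau : set Q.
Hypotheses (sigma_face : face Qp sigma) (tau_face : face Qp tau).

Let sigma_sub : submonoid sigma. Proof. by case: sigma_face. Qed.
Let tau_sub : submonoid tau. Proof. by case: tau_face. Qed.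

Lemma face_join_face : face Qp (face_join sigma tau).
Proof.
have /submonoidP[s0 sD] := sigma_sub; have /submonoidP[t0 tD] := tau_sub.
apply: face_of_summand => [|x []//|x y Qpx Qpy [_ below]]; last first.
  by split=> //; exact: diffset_below below.
apply/submonoidP; split=> [|x y].
  split=> //; apply: sub_diffset.
  by exists 0 => //; exists 0; rewrite ?addr0.
move=> [Qpx [_ [a sa [b tb <-]] [p Qpp xE]]].
move=> [Qpy [_ [c sc [d td <-]] [r Qpr yE]]].
split; first exact: QpD.
exists (a + c + (b + d)).
  by exists (a + c); [exact: sD|exists (b + d) => //; exact: tD].
exists (p + r); first exact: QpD.
by rewrite -xE -yE opprD [RHS]addrACA [a + b + _]addrACA.
Qed.

Lemma face_join_subl : sigma `<=` face_join sigma tau.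
Proof.
have /submonoidP[t0 _] := tau_sub; have [_ s_Qp _] := sigma_face.
move=> x sx; split; first exact: s_Qp.
by apply: sub_diffset; exists x => //; exists 0; rewrite ?addr0.
Qed.

Lemma face_join_subr : tau `<=` face_join sigma tau.
Proof.
have /submonoidP[s0 _] := sigma_sub; have [_ t_Qp _] := tau_face.
move=> x tx; split; first exact: t_Qp.
by apply: sub_diffset; exists 0 => //; exists x; rewrite ?add0r.
Qed.

End FaceJoin.

Lemma localization_sub tau D : localization tau D `<=` D.
Proof. by move=> q []. Qed.

Lemma localizationS tau D E :
  D `<=` E -> localization tau D `<=` localization tau E.
Proof. by move=> DE q [Dq tD]; split; [exact: DE|exact: subset_trans DE]. Qed.

Lemma downset_localization tau D :
  downset Qp D -> downset Qp (localization tau D).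
Proof.
move=> /downsetP downD; apply/downsetP => x p Qpp [Dxp tD].
split; first exact: downD Dxp.
move=> _ [t tt <-]; apply: (downD _ p) => //.
by rewrite addrAC; apply: tD; exists t.
Qed.

Lemma localization_face_join sigma tau D :
  downset Qp D ->
  localization tau (localization sigma D) `<=`
  localization (face_join sigma tau) D.
Proof.
move=> /downsetP downD q [[Dq _] tD]; split=> //.
move=> _ [x [_ [_ [s ss [t tt <-]] [p Qpp xE]]] <-].
apply: (downD _ p) => //; rewrite -addrA -xE subrK [s + t]addrC addrA.
have [|_] := tD (q + t); first by exists t.
by apply; exists s.
Qed.

(** Localizations are downsets, so moving up by [t] cannot bring a point into
    a localization that it did not already belong to. *)
Lemma local_support_translate tau D q t :
  face Qp tau -> downset Qp D ->
  local_support Qp tau D q -> tau t -> local_support Qp tau D (q + t).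
Proof.
move=> [/submonoidP[_ tD] t_Qp _] downD [[Dq tauD] supp] tt.
split=> [|tau' ftau' ntau' loc].
  split=> [|_ [u tu <-]]; first by apply: tauD; exists t.
  by rewrite -addrA; apply: tauD; exists (t + u) => //; exact: tD.
apply: (supp _ ftau' ntau').
have /downsetP down :=
  downset_localization tau' (downset_localization tau downD).
by apply: down loc; exact: t_Qp.
Qed.

Lemma primary_component_sub tau D :
  downset Qp D -> primary_component Qp tau D `<=` D.
Proof.
move=> downD; apply: diffset_sub_downset => // q [loc _].
exact: localization_sub loc.
Qed.

Lemma local_support_component tau D :
  face Qp tau -> downset Qp D ->
  local_support Qp tau D `<=` local_support Qp tau (primary_component Qp tau D).
Proof.
move=> ftau downD q Sq; split=> [|tau' ftau' ntau' loc].
  split; first exact: sub_diffset.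
  by move=> _ [t tt <-]; apply: sub_diffset; exact: local_support_translate.
have [_ /(_ _ ftau' ntau')] := Sq; apply; move: loc.
by do 2 apply: localizationS; exact: primary_component_sub.
Qed.

Lemma coprimary_component tau D :
  face Qp tau -> downset Qp D -> coprimary Qp (primary_component Qp tau D).
Proof.
move=> ftau downD; split; first exact: downset_diffset.
exists tau => //; apply/seteqP; split; last first.
  by apply: primary_component_sub; exact: downset_diffset.
move=> _ [s Ss [r Qpr <-]]; exists s; first exact: local_support_component.
by exists r.
Qed.

Lemma downset_sub_components D :
  unit_group Qp = [set 0] -> polyhedral Qp -> downset Qp D ->
  D `<=` \bigcup_(tau in [set tau | face Qp tau /\ local_support Qp tau D !=set0])
           primary_component Qp tau D.
Proof.
move=> units Qpoly downD q Dq.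
pose meets tau := face Qp tau /\
  exists2 p, Qp p & localization tau D (q + p).
have meets0 : meets [set 0].
  split; first exact: face0.
  by exists 0; rewrite ?addr0 //; split=> // _ [_ -> <-]; rewrite addr0.
have [tau [_ [ftau [p Qpp locp]] maxtau]] :=
  finite_maximal_above Qpoly meets0.
(* If [q + p] survived along [tau'], it would witness that the join of [tau] and
   [tau'] is also a candidate, so the join cannot exceed [tau]. *)
have Sp : local_support Qp tau D (q + p).
  split=> // tau' ftau' + loc; apply.
  apply: subset_trans (face_join_subr ftau ftau') _.
  have fjoin := face_join_face ftau ftau'.
  apply: maxtau => //; last exact: face_join_subl.
  by split=> //; exists p => //; exact: localization_face_join.
exists tau; first by split=> //; exists (q + p).
by exists (q + p) => //; exists p; rewrite ?addrK.
Qed.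

End PrimaryComponents.

Theorem corollary3p20 (Q : zmodType) (Qp : set Q)
    (Qpo : partially_ordered Qp) (Qpoly : polyhedral Qp)
    (D : set Q) (Ddown : downset Qp D) :
  primary_decomposition Qp D
    [set tau | face Qp tau /\ local_support Qp tau D !=set0]
    (fun tau => primary_component Qp tau D).
Proof.
have [Qp_sub _ units] := Qpo; split=> [|tau [ftau _]|].
- by apply: sub_finite_set Qpoly => tau [].
- exact: coprimary_component.
- apply/seteqP; split; first exact: downset_sub_components.
  by move=> q [tau _]; exact: primary_component_sub.
Qed.
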